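(* Let $\mathcal{H}_k$ be a semi-analytic tridiagonal space corresponding to the orthonormal basis $\{f_n\}_{n\ge 0}$, $f_n(z)=(a_n+b_nz)z^n$. Assume that the shift $M_z$ is a non-normal operator on $\mathcal{H}_k$. Then $M_z$ is quasinormal if and only if there exists a positive real number $r$ such that $$M_z^*M_z-M_zM_z^*=r\,P_{f_0},$$ where $P_{f_0}$ denotes the orthogonal projection of $\mathcal{H}_k$ onto the one-dimensional space $\mathbb{C}f_0$.
   Context: $\mathbb{D}$ is the open unit disc, $\mathcal{O}(\mathbb{D})$ the space of analytic functions on $\mathbb{D}$. For a positive definite scalar kernel $k$ on $\mathbb{D}$, analytic in the first variable, $\mathcal{H}_k$ is its reproducing kernel Hilbert space of analytic functions, and the shift $M_z$ is $(M_zf)(w)=wf(w)$. A semi-analytic tridiagonal space is such an $\mathcal{H}_k$ with $\mathbb{C}[z]\subseteq\mathcal{H}_k\subseteq\mathcal{O}(\mathbb{D})$ for which there are complex scalars $\{a_n\}_{n\ge 0}$, $\{b_n\}_{n\ge 0}$ with $a_n\ne 0$ for all $n$, $\sup_{n}|a_n/a_{n+1}|<\infty$, $\limsup_{n}|b_n/a_{n+1}|<1$, and such that $f_n(z)=(a_n+b_nz)z^n$, $n\ge 0$, form an orthonormal basis of $\mathcal{H}_k$ (so $k(z,w)=\sum_{n\ge0}f_n(z)\overline{f_n(w)}$). These conditions ensure that $M_z$ is bounded on $\mathcal{H}_k$. A bounded operator $T$ is quasinormal if $T^*T$ and $T$ commute, i.e. $(T^*T-TT^* )T=0$. *)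

(* Defs.v *)
From HB Require Import structures.
From mathcomp Require Import all_boot all_order all_algebra.
From mathcomp Require Import sesquilinear complex.
From mathcomp Require Import all_classical all_reals all_analysis.

Set Implicit Arguments.
Unset Strict Implicit.
Unset Printing Implicit Defensive.

Import Order.TTheory GRing.Theory Num.Theory Num.Def.
Import numFieldNormedType.Exports.

Local Open Scope classical_set_scope.
Local Open Scope complex_scope.
Local Open Scope ring_scope.

Definition disc (R : realType) : Type := {z : R[i] | `|z| < 1}.

(* Complex differentiability at the points of the disc, an open set; it only
   depends on the values of the extension G on the disc. *)
Definition analytic (R : realType) (g : disc R -> R[i]) : Prop :=
  exists2 G : R[i]^o -> R[i]^o,
    (forall w : disc R, G (val w) = g w) &
    (forall w : disc R, derivable G (val w) 1).

Definition disc_kernel (R : realType) := disc R -> disc R -> R[i].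

Definition posdef_kernel (R : realType) (k : disc_kernel R) : Prop :=
  forall (n : nat) (x : 'I_n -> disc R) (c : 'I_n -> R[i]),
    0 <= \sum_(i < n) \sum_(j < n) conjC (c i) * c j * k (x i) (x j).

Definition analytic_kernel (R : realType) (k : disc_kernel R) : Prop :=
  forall w : disc R, analytic (fun z => k z w).

(* The reproducing kernel Hilbert space of k.  A vector is identified with the
   function on the disc given by ev, which is linear and injective.  The inner
   product is linear in its first argument. *)
Record rkhs (R : realType) (k : disc_kernel R) := Rkhs {
  hilb :> completeNormedModType R[i];
  inner : {dot hilb for conjC};
  ev : hilb -> disc R -> R[i];
  kernel_section : disc R -> hilb;
  normE : forall x : hilb, `|x| ^+ 2 = inner x x;
  ev_linear : forall (c : R[i]) (x y : hilb) (w : disc R),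
    ev (c *: x + y) w = c * ev x w + ev y w;
  ev_inj : injective ev;
  ev_section : forall z w : disc R, ev (kernel_section w) z = k z w;
  reproducing : forall (x : hilb) (w : disc R), inner x (kernel_section w) = ev x w
}.

Arguments inner {R k} _.
Arguments ev {R k} _.

Section Operators.
Variables (R : realType) (k : disc_kernel R) (H : rkhs k).

Definition orthonormal_basis (e : nat -> H) : Prop :=
  (forall m n, inner H (e m) (e n) = (m == n)%:R) /\
  closure [set x : H | exists n (c : 'I_n -> R[i]),
                         x = \sum_(i < n) c i *: e i] = setT.

Definition bounded_op (T : H -> H) : Prop :=
  linear T /\ exists M : R, forall x, `|T x| <= M%:C * `|x|.

(* The vector representing x |-> <T x, y>: it is unique, and by Riesz it exists
   when T is a bounded operator; the default value 0 is used otherwise. *)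
Definition adjoint (T : H -> H) (y : H) : H :=
  xget 0 [set z | forall x, inner H (T x) y = inner H x z].

Definition normal_op (T : H -> H) : Prop :=
  bounded_op T /\ forall x, adjoint T (T x) = T (adjoint T x).

Definition quasinormal_op (T : H -> H) : Prop :=
  bounded_op T /\
  forall x, adjoint T (T (T x)) - T (adjoint T (T x)) = 0.

Definition span_line (v : H) : set H := [set x | exists c : R[i], x = c *: v].

(* For a closed subspace V, such as a line, the set below is a singleton. *)
Definition orth_proj (V : set H) (x : H) : H :=
  xget 0 [set y | V y /\ forall v, V v -> inner H (x - y) v = 0].

(* The function w |-> w * f w, as a vector of H; the default value 0 is used
   when this function is not in H, which does not happen for the spaces of
   [semi_analytic_tridiagonal]. *)
Definition mult_z (f : H) : H :=
  xget 0 [set g | forall w, ev H g w = val w * ev H f w].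

Record semi_analytic_tridiagonal (a b : nat -> R[i]) (f : nat -> H) : Prop := {
  sat_poly : forall p : {poly R[i]},
    exists g : H, forall w, ev H g w = p.[val w];
  sat_analytic : forall g : H, analytic (ev H g);
  sat_neq0 : forall n, a n != 0;
  sat_sup :
    (ereal_sup (range (fun n => (Normc.normc (a n / a n.+1))%:E))
       < +oo)%E;
  sat_limsup :
    (limn_esup (fun n => (Normc.normc (b n / a n.+1))%:E) < 1%:E)%E;
  sat_ev : forall n w, ev H (f n) w = (a n + b n * val w) * val w ^+ n;
  sat_basis : orthonormal_basis f
}.

End Operators.

Arguments mult_z {R k} H.

(* Main.v *)
Require Import Defs.
From mathcomp Require Import all_boot all_order all_algebra.
From mathcomp Require Import sesquilinear complex.
From mathcomp Require Import all_classical all_reals all_analysis.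
From mathcomp Require Import ring lra.
Set Implicit Arguments.
Unset Strict Implicit.
Unset Printing Implicit Defensive.

Import Order.TTheory GRing.Theory Num.Theory.
Import numFieldNormedType.Exports.
Local Open Scope complex_scope.
Local Open Scope ring_scope.

(** Write [t n = b n / a n.+1], [s n = a n / a n.+1] and [u n = a n * w ^ n].
    Then [f n (w) = u n + t n * u n.+1] and [w * u n = s n * u n.+1].

    Boundedness of the shift [T].  If [c n] are the coordinates of [x] in the
    basis [f], the function [w * x (w)] has formal coordinates [g n] given by
    the recursion [g n.+1 = s n * (c n + t n.-1 * c n.-1) - t n * g n]
    (the term in [n.-1] being absent for [n = 0]).  As
    [|t n|] is eventually below some [rho < 1], this recursion is stable in l2
    ([l2_recursion]), so that [g] is the coordinate sequence of a vector [z],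
    of norm at most a constant times that of [x] ([riesz_fischer]).  The partial
    sums of [z (w)] and of [w * x (w)] differ by boundary terms
    ([shift_partial_sums]), which tend to [0] because [u] is bounded: [2 * u n]
    is the sum of the values of [f n] at [w] and, up to sign, at [- w].  Hence
    [T x = z] ([shift_exists]).  The adjoint [A] of [T] is then built coordinate
    by coordinate ([adjoint_exists]).

    The equivalence.  As [x (0) = a 0 * <x, f 0>], the range of [T] is
    orthogonal to [f 0]; it contains [f n.+1], which is [w] times a polynomial.
    Let [Q = A T - T A].  If [Q = r P] with [P] the projection on [f 0], then
    [Q T = 0].  Conversely, if [Q T = 0], then for the self-adjoint [Q]
    [<Q x, T p> = <x, Q T p> = 0], so [Q] takes its values in the line of [f 0],
    and self-adjointness gives [Q = r P] with
    [r = <Q f 0, f 0> = |T f 0| ^ 2 - |A f 0| ^ 2 = |T f 0| ^ 2 >= 0].  Non-normality,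
    that is [Q <> 0], excludes [r = 0] ([quasinormal_rank_one]). *)

(** * Moduli of complex numbers *)

Section Modulus.
Variable R : realType.
Implicit Types z w : R[i].

Lemma realC_inj (x y : R) : x%:C = y%:C -> x = y.
Proof. by case. Qed.

(** The modulus with values in [R], whose order is total, rather than in
    [R[i]]. *)
Definition cmod z : R := Normc.normc z.

Lemma normE_cmod z : `|z| = (cmod z)%:C.
Proof. by []. Qed.

Lemma cmod_ge0 z : 0 <= cmod z.
Proof. by rewrite -ler0c -normE_cmod. Qed.

Lemma cmodM z w : cmod (z * w) = cmod z * cmod w.
Proof. exact: Normc.normcM. Qed.

Lemma cmodN z : cmod (- z) = cmod z.
Proof. exact: normcN. Qed.

Lemma ler_cmodD z w : cmod (z + w) <= cmod z + cmod w.
Proof. exact: le_normcD. Qed.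

Lemma cmod_sqr z : (cmod z ^+ 2)%:C = z * z^*.
Proof. by rewrite rmorphXn /= -normE_cmod normCK. Qed.

Lemma conj_realC (x : R) : (x%:C)^* = x%:C.
Proof. exact: conjc_real. Qed.

Lemma cmod0 : cmod 0 = 0.
Proof. exact: Normc.normc0. Qed.

Lemma cmod0_eq0 z : cmod z = 0 -> z = 0.
Proof. exact: Normc.eq0_normc. Qed.

End Modulus.

(** * Hilbert spaces with a countable orthonormal basis *)

Section Hilbert.
Variables (R : realType).
Local Notation C := (complex_complex__canonical__Num_NumField R).
Variables (U : completeNormedModType C) (form : {dot U for (@Num.conj R[i])}).
Hypothesis form_norm : forall x : U, `|x| ^+ 2 = form x x.
Implicit Types x y z : U.

(** The inner product retyped in [R[i]], where the field operations are
    inferred. *)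
Definition ip x y : R[i] := form x y.

Local Notation "<< x , y >>" := (ip x y).

Definition nrm x : R := complex.Re `|x|.

Lemma normE_nrm x : `|x| = (nrm x)%:C.
Proof. by rewrite RRe_real // normr_real. Qed.

Lemma nrm_ge0 x : 0 <= nrm x.
Proof. by rewrite -ler0c -normE_nrm. Qed.

Lemma ler_nrmD x y : nrm (x + y) <= nrm x + nrm y.
Proof. by rewrite -lecR rmorphD /= -!normE_nrm ler_normD. Qed.

Lemma nrmB x y : nrm (x - y) = nrm (y - x).
Proof. by apply: realC_inj; rewrite -!normE_nrm distrC. Qed.

Lemma nrm_gt0 x : (0 < nrm x) = (x != 0).
Proof. by rewrite -ltcR -normE_nrm normr_gt0. Qed.

Lemma nrm_eq0 x : (nrm x == 0) = (x == 0).
Proof. by rewrite -(normr_eq0 x) normE_nrm -(inj_eq (@complexI R)). Qed.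

Lemma nrm_sqr x : (nrm x ^+ 2)%:C = << x, x >>.
Proof. by rewrite rmorphXn /= -normE_nrm form_norm. Qed.

Lemma ipC x y : << x, y >> = << y, x >>^*.
Proof. by rewrite /ip hermC expr0 mul1r. Qed.

Lemma ipDl x y z : << x + y, z >> = << x, z >> + << y, z >>.
Proof. exact: linearDl. Qed.

Lemma ipDr x y z : << x, y + z >> = << x, y >> + << x, z >>.
Proof. exact: linearDr. Qed.

Lemma ipZl (c : R[i]) x y : << c *: x, y >> = c * << x, y >>.
Proof. exact: linearZl_LR. Qed.

Lemma ipZr (c : R[i]) x y : << x, c *: y >> = c^* * << x, y >>.
Proof. exact: linearZr_LR. Qed.

Lemma ipBl x y z : << x - y, z >> = << x, z >> - << y, z >>.
Proof. exact: linearBl. Qed.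

Lemma ipBr x y z : << x, y - z >> = << x, y >> - << x, z >>.
Proof. exact: linearBr. Qed.

Lemma ip0r x : << x, 0 >> = 0.
Proof. exact: linear0r. Qed.

Lemma ip_suml (I : Type) (s : seq I) (P : pred I) (F : I -> U) y :
  << \sum_(i <- s | P i) F i, y >> = \sum_(i <- s | P i) << F i, y >>.
Proof. exact: linear_sumlz. Qed.

Lemma ip_sumr (I : Type) (s : seq I) (P : pred I) (F : I -> U) x :
  << x, \sum_(i <- s | P i) F i >> = \sum_(i <- s | P i) << x, F i >>.
Proof. exact: linear_sumr. Qed.

(** Expand the squared norm of [<y, y> x - <x, y> y]. *)
Lemma cauchy_schwarz x y : cmod << x, y >> <= nrm x * nrm y.
Proof.
have [->|y0] := eqVneq y 0.
  by rewrite ip0r cmod0 mulr_ge0 ?nrm_ge0.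
have ny : 0 < nrm y by rewrite nrm_gt0.
rewrite -(@ler_pXn2r _ 2%N) ?nnegrE ?cmod_ge0 ?mulr_ge0 ?nrm_ge0 // exprMn.
have key : nrm (<< y, y >> *: x - << x, y >> *: y) ^+ 2 =
    nrm y ^+ 2 * (nrm x ^+ 2 * nrm y ^+ 2 - cmod << x, y >> ^+ 2).
  apply: realC_inj; rewrite nrm_sqr rmorphM rmorphB /= cmod_sqr nrm_sqr rmorphM /= !nrm_sqr.
  rewrite ipBl !ipBr !ipZl !ipZr [<< y, x >>]ipC -[<< y, y >>^*]ipC; ring.
rewrite -subr_ge0 -(pmulr_rge0 _ (exprn_gt0 2 ny)) -key.
exact: sqr_ge0.
Qed.

Definition orthonormal_seq (e : nat -> U) :=
  forall m n, << e m, e n >> = (m == n)%:R.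

Definition total_seq (e : nat -> U) :=
  closure [set x : U | exists n (c : 'I_n -> R[i]), x = \sum_(i < n) c i *: e i]
  = setT.

Section Orthonormal.
Variable e : nat -> U.
Hypothesis e_on : orthonormal_seq e.

Lemma ip_lincomb (c : nat -> R[i]) m n j :
  << \sum_(m <= i < n) c i *: e i, e j >> = if (m <= j < n)%N then c j else 0.
Proof.
rewrite ip_suml.
under eq_bigr do rewrite ipZl e_on.
case: ifP => mjn.
  rewrite (big_rem j) ?mem_index_iota //= eqxx mulr1 big1_seq ?addr0 // => i.
  rewrite mem_rem_uniq ?iota_uniq // inE /= => /andP[/negbTE -> _].
  by rewrite mulr0.
rewrite big1_seq // => i; rewrite /= mem_index_iota.
by case: eqP => [->|_ _]; rewrite ?mulr0 // mjn.
Qed.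

Lemma nrm_sqr_lincomb (c : nat -> R[i]) m n :
  nrm (\sum_(m <= i < n) c i *: e i) ^+ 2 = \sum_(m <= i < n) cmod (c i) ^+ 2.
Proof.
apply: realC_inj; rewrite nrm_sqr ip_sumr rmorph_sum /=.
rewrite big_seq [RHS]big_seq; apply: eq_bigr => i; rewrite mem_index_iota => mi.
by rewrite ipZr ip_lincomb mi cmod_sqr mulrC.
Qed.

Definition expansion x N := \sum_(0 <= i < N) << x, e i >> *: e i.

Lemma expansionB x y N : expansion (x - y) N = expansion x N - expansion y N.
Proof.
by rewrite /expansion -sumrB; apply: eq_bigr => i _; rewrite ipBl scalerBl.
Qed.

Lemma expansion_id (c : nat -> R[i]) n N : (n <= N)%N ->
  expansion (\sum_(0 <= i < n) c i *: e i) N = \sum_(0 <= i < n) c i *: e i.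
Proof.
move=> nN; rewrite /expansion (big_cat_nat (leq0n n) nN) /= [X in _ + X]big_nat.
rewrite [X in _ + X]big1 ?addr0 => [|i /andP[ni _]]; last first.
  by rewrite ip_lincomb /= ltnNge ni scale0r.
rewrite big_nat [RHS]big_nat; apply: eq_bigr => i /andP[_ iN].
by rewrite ip_lincomb /= iN.
Qed.

Lemma pythagoras x N :
  nrm x ^+ 2 = nrm (x - expansion x N) ^+ 2 + \sum_(0 <= i < N) cmod << x, e i >> ^+ 2.
Proof.
rewrite -nrm_sqr_lincomb -/(expansion x N).
have perp : << x - expansion x N, expansion x N >> = 0.
  rewrite {2}/expansion ip_sumr big_nat big1 // => i /andP[_ iN].
  by rewrite ipZr ipBl ip_lincomb /= iN subrr mulr0.
have xE : x = (x - expansion x N) + expansion x N by rewrite subrK.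
move: (expansion x N) (x - expansion x N) xE perp => p d -> perp.
apply: realC_inj; rewrite rmorphD /= !nrm_sqr ipDl !ipDr.
by rewrite (ipC p d) perp conjC0 addr0 add0r.
Qed.

Lemma bessel x N : \sum_(0 <= i < N) cmod << x, e i >> ^+ 2 <= nrm x ^+ 2.
Proof. by rewrite (pythagoras x N) lerDr sqr_ge0. Qed.

Lemma expansion_contract x N : nrm (x - expansion x N) <= nrm x.
Proof.
rewrite -(@ler_pXn2r _ 2%N) ?nnegrE ?nrm_ge0 // (pythagoras x N) lerDl.
by apply: sumr_ge0 => i _; apply: sqr_ge0.
Qed.

(** Long partial expansions fix a given linear combination [v] of [e], so the
    error at [x] equals the error at [x - v], which is at most [nrm (x - v)];
    totality makes this small. *)
Lemma expansion_approx : total_seq e -> forall x (eps : R), 0 < eps ->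
  exists n, forall N, (n <= N)%N -> nrm (x - expansion x N) < eps.
Proof.
move=> e_tot x eps eps0.
have : closure [set x : U | exists n (c : 'I_n -> R[i]), x = \sum_(i < n) c i *: e i] x.
  by rewrite e_tot.
have eps0' : 0 < eps%:C :> C by rewrite ltcR.
move=> /(_ _ (nbhsx_ballx x _ eps0')) [_ [[n [c ->]] xv]].
pose c' i := oapp c 0 (insub i).
have cE : \sum_(i < n) c i *: e i = \sum_(0 <= i < n) c' i *: e i.
  by rewrite big_mkord; apply: eq_bigr => i _; rewrite /c' valK.
exists n => N nN; apply: le_lt_trans (_ : nrm (x - \sum_(i < n) c i *: e i) < _).
  apply: le_trans (expansion_contract _ N); rewrite expansionB.
  rewrite cE expansion_id //.
  by rewrite opprB addrA subrK.
move: xv; rewrite -ball_normE /= normE_nrm.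
by rewrite ltcR.
Qed.

End Orthonormal.

(** Completeness with an explicit modulus [delta], which turns later passages
    to the limit into inequalities. *)
Lemma cauchy_limit (u : nat -> U) (delta : nat -> R) :
  (forall m n, (n <= m)%N -> nrm (u m - u n) <= delta n) ->
  (forall eps : R, 0 < eps -> exists n, delta n < eps) ->
  exists l, forall n, nrm (l - u n) <= delta n.
Proof.
move=> u_delta delta0.
have u_cvg : cvg (u @ \oo)%classic.
  apply: cauchy_cvg; apply: cauchy_exP => eps eps0.
  have epsE : eps = (complex.Re eps)%:C by rewrite RRe_real // gtr0_real.
  have [|n dn] := delta0 (complex.Re eps); first by rewrite -ltcR -epsE.
  exists (u n); exists n => // m /= nm.
  rewrite -ball_normE /= normE_nrm epsE ltcR nrmB.
  exact: le_lt_trans (u_delta _ _ nm) dn.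
exists (lim (u @ \oo))%classic => n; apply/ler_addgt0Pr => eps eps0.
have eps0' : 0 < eps%:C :> C by rewrite ltcR.
have /cvgrPdist_lt /(_ _ eps0') [m0 _ um0] := u_cvg.
pose m := maxn m0 n.
have := um0 m; rewrite /= leq_maxl normE_nrm => /(_ isT).
rewrite ltcR => um.
have -> : (lim (u @ \oo))%classic - u n
    = (lim (u @ \oo))%classic - u m + (u m - u n).
  by rewrite addrA subrK.
apply: le_trans (ler_nrmD _ _) _; rewrite addrC.
by apply: lerD; [apply: u_delta; apply: leq_maxr | apply: ltW].
Qed.

Section RieszFischer.
Variable e : nat -> U.
Hypothesis e_on : orthonormal_seq e.

Lemma nrm_orthonormal n : nrm (e n) = 1.
Proof.
have /eqP : nrm (e n) ^+ 2 = 1.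
  by apply: realC_inj; rewrite nrm_sqr e_on eqxx.
by rewrite sqrf_eq1 (gt_eqF (lt_le_trans (ltrN10 _) (nrm_ge0 _))) orbF => /eqP.
Qed.

(** The partial sums are Cauchy with modulus [sqrt (T - s n)], where [s n] are
    the partial sums of the squared moduli and [T] is their supremum. *)
Lemma riesz_fischer (c : nat -> R[i]) (S : R) :
  (forall N, \sum_(0 <= i < N) cmod (c i) ^+ 2 <= S) ->
  exists z, (forall n, << z, e n >> = c n) /\ nrm z ^+ 2 <= S.
Proof.
move=> cS; pose s N := \sum_(0 <= i < N) cmod (c i) ^+ 2.
pose u N := \sum_(0 <= i < N) c i *: e i.
have s_inc m n : (n <= m)%N -> s n <= s m.
  move=> nm; rewrite /s (big_cat_nat (leq0n n) nm) /= lerDl.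
  by apply: sumr_ge0 => i _; apply: sqr_ge0.
have sup_s : has_sup (range s).
  by split; [exists (s 0%N), 0%N | exists S => _ [N _ <-]; apply: cS].
pose T := sup (range s).
have sT N : s N <= T by apply: (sup_upper_bound sup_s); exists N.
pose delta N := Num.sqrt (T - s N).
have delta_inc m n : (n <= m)%N -> delta m <= delta n.
  by move=> nm; apply: ler_wsqrtr; rewrite lerD2l lerN2 s_inc.
have delta_small (eps : R) : 0 < eps -> exists n, delta n < eps.
  move=> eps0; have [_ [n _ <-] sn] := sup_adherent (exprn_gt0 2 eps0) sup_s.
  exists n; rewrite -[eps]gtr0_norm // -sqrtr_sqr ltr_sqrt ?exprn_gt0 //.
  by rewrite ltrBlDr -ltrBlDl.
have u_delta m n : (n <= m)%N -> nrm (u m - u n) <= delta n.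
  move=> nm; rewrite /u (big_cat_nat (leq0n n) nm) /= addrAC subrr add0r.
  rewrite -[nrm _]ger0_norm ?nrm_ge0 // -sqrtr_sqr ler_wsqrtr //.
  rewrite nrm_sqr_lincomb // lerBrDl; have := sT m.
  by rewrite /s (big_cat_nat (leq0n n) nm).
have [z zu] := cauchy_limit u_delta delta_small.
exists z; split => [n|].
  apply/eqP; rewrite -subr_eq0; apply/eqP/cmod0_eq0/eqP.
  rewrite eq_le cmod_ge0 andbT; apply/ler_addgt0Pr => eps eps0; rewrite add0r.
  have [N0 dN0] := delta_small _ eps0; pose N := maxn N0 n.+1.
  have -> : << z, e n >> - c n = << z - u N, e n >>.
    by rewrite ipBl ip_lincomb //= leq_maxr.
  apply: le_trans (cauchy_schwarz _ _) _; rewrite nrm_orthonormal mulr1.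
  apply: le_trans (zu N) _; apply: le_trans (delta_inc _ _ (leq_maxl _ _)) _.
  exact: ltW.
have S0 : 0 <= S by have := cS 0%N; rewrite big_geq.
rewrite -(@ger0_norm _ (nrm z)) ?nrm_ge0 // -ler_sqrt // sqrtr_sqr normr_id.
rewrite ger0_norm ?nrm_ge0 //; apply/ler_addgt0Pr => eps eps0.
have [N dN] := delta_small _ eps0.
rewrite -[z](subrK (u N)) [leRHS]addrC.
apply: le_trans (ler_nrmD _ _) _; apply: lerD.
  exact: le_trans (zu N) (ltW dN).
rewrite -[nrm _]ger0_norm ?nrm_ge0 // -sqrtr_sqr ler_wsqrtr //.
by rewrite nrm_sqr_lincomb.
Qed.

Hypothesis e_tot : total_seq e.

(** Partial expansions of [x] are mapped to [0], and their error can be made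
    arbitrarily small. *)
Lemma functional_ext (phi : U -> R[i]) (M : R) :
  (forall (c : R[i]) x y, phi (c *: x + y) = c * phi x + phi y) ->
  (forall x, cmod (phi x) <= M * nrm x) ->
  (forall n, phi (e n) = 0) -> forall x, phi x = 0.
Proof.
move=> phi_lin phi_M phi_e x.
have phi0 : phi 0 = 0.
  have := phi_lin 1 0 0; rewrite scale1r mul1r addr0 => /esym /eqP.
  by rewrite -[X in _ == X]addr0 (inj_eq (addrI _)) => /eqP.
have phi_expansion N : phi (expansion e x N) = 0.
  rewrite /expansion; elim: N => [|N IH]; first by rewrite big_geq.
  by rewrite big_nat_recr //= addrC phi_lin phi_e mulr0 add0r.
apply/cmod0_eq0/eqP; rewrite eq_le cmod_ge0 andbT.
apply/ler_addgt0Pr => eps eps0; rewrite add0r.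
pose M' := `|M| + 1.
have M'0 : 0 < M' by rewrite ltr_wpDl.
have [N /(_ N (leqnn N)) xN] := expansion_approx e_on e_tot x (divr_gt0 eps0 M'0).
have -> : phi x = phi (x - expansion e x N).
  by rewrite -{1}(subrK (expansion e x N) x) -[_ - _]scale1r phi_lin phi_expansion mul1r addr0 scale1r.
apply: le_trans (phi_M _) _; apply: le_trans (_ : M' * nrm (x - expansion e x N) <= _).
  apply: ler_wpM2r; first exact: nrm_ge0.
  by apply: le_trans (ler_norm _) _; rewrite lerDl.
by rewrite mulrC -ler_pdivlMr // ltW.
Qed.

Lemma eq_from_coord x y : (forall n, << x, e n >> = << y, e n >>) -> x = y.
Proof.
move=> xy; apply/eqP; rewrite -subr_eq0 -nrm_eq0 -sqrf_eq0.
apply/eqP/realC_inj; rewrite nrm_sqr.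
apply: (@functional_ext (fun v => << v, x - y >>) (nrm (x - y))) => [c v v'|v|n].
- by rewrite ipDl ipZl.
- by rewrite mulrC cauchy_schwarz.
- by rewrite ipC ipBl xy subrr rmorph0.
Qed.

(** The representing vector must have coordinates [c n = <y, T (e n)>].  They are
    square summable: for [v] the partial sum of [c n *: e n],
    [|v| ^ 2 = <y, T v> <= |y| * M * |v|]. *)
Lemma adjoint_exists (T : U -> U) (M : R) :
  (forall (c : R[i]) x y, T (c *: x + y) = c *: T x + T y) ->
  0 <= M -> (forall x, nrm (T x) <= M * nrm x) ->
  forall y, exists z, forall x, << T x, y >> = << x, z >>.
Proof.
move=> T_lin M0 T_M y; pose c n := << y, T (e n) >>.
have T0 : T 0 = 0.
  have := T_lin 1 0 0; rewrite !scale1r addr0 => /esym /eqP.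
  by rewrite -[X in _ == X]addr0 (inj_eq (addrI _)) => /eqP.
have [|z [zc _]] := @riesz_fischer c ((M * nrm y) ^+ 2).
  move=> N; set sigma := \sum_(_ <= _ < _) _.
  pose v := \sum_(0 <= i < N) c i *: e i.
  have Tv : T v = \sum_(0 <= i < N) c i *: T (e i).
    rewrite /v; elim: N {sigma v} => [|N IH]; first by rewrite !big_geq.
    by rewrite !big_nat_recr //= addrC T_lin IH addrC.
  have yTv : << y, T v >> = sigma%:C.
    rewrite Tv ip_sumr rmorph_sum /=; apply: eq_bigr => i _.
    by rewrite ipZr cmod_sqr mulrC.
  have vE : nrm v ^+ 2 = sigma by rewrite nrm_sqr_lincomb.
  have sigma0 : 0 <= sigma by rewrite -vE sqr_ge0.
  have sigma_le : sigma <= M * nrm y * nrm v.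
    have -> : sigma = cmod << y, T v >>.
      by apply: realC_inj; rewrite yTv -normE_cmod ger0_norm // ler0c.
    apply: le_trans (cauchy_schwarz _ _) _.
    rewrite [M * _]mulrC -mulrA; apply: ler_wpM2l (T_M v); exact: nrm_ge0.
  have := nrm_ge0 v; rewrite le_eqVlt => /predU1P[v0|v0].
    by rewrite -vE -v0 expr0n sqr_ge0.
  rewrite -vE ler_pXn2r ?nnegrE ?mulr_ge0 ?nrm_ge0 //.
  by rewrite -(ler_pM2r v0) -expr2 vE.
exists z => x; apply/eqP; rewrite -subr_eq0; apply/eqP.
apply: (@functional_ext (fun x => << T x, y >> - << x, z >>)
          (M * nrm y + nrm z)) => {x} [d x x'|x|n].
- by rewrite T_lin !ipDl !ipZl; ring.
- apply: le_trans (ler_cmodD _ _) _; rewrite cmodN mulrDl.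
  apply: lerD; last by rewrite mulrC cauchy_schwarz.
  apply: le_trans (cauchy_schwarz _ _) _.
  by rewrite mulrAC ler_wpM2r ?nrm_ge0.
- by rewrite [<< e n, z >>]ipC zc /c [X in X - _]ipC subrr.
Qed.

(** [Q := A T - T A] is self-adjoint, so [Q T = 0] makes the range of [Q]
    orthogonal to the range of [T], that is, contained in the line of [e 0]. *)
Lemma quasinormal_rank_one (T A : U -> U) :
  (forall x y, << T x, y >> = << x, A y >>) ->
  (forall x, << T x, e 0%N >> = 0) ->
  (forall n, exists p, T p = e n.+1) ->
  ~ (forall x, A (T x) = T (A x)) ->
  (forall x, A (T (T x)) - T (A (T x)) = 0) <->
  exists2 r : R, 0 < r &
    forall x, A (T x) - T (A x) = r%:C *: (<< x, e 0%N >> *: e 0%N).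
Proof.
move=> TA T_perp T_range T_nonnormal; split; last first.
  by move=> [r _ QE] x; rewrite QE T_perp scale0r scaler0.
move=> QT0; pose Q x := A (T x) - T (A x).
have AT x y : << A x, y >> = << x, T y >> by rewrite ipC -TA -ipC.
have Q_sa x y : << Q x, y >> = << x, Q y >>.
  by rewrite /Q ipBl ipBr AT !TA -AT.
have A_e0 : A (e 0%N) = 0.
  apply/eqP; rewrite -nrm_eq0 -sqrf_eq0; apply/eqP/realC_inj.
  by rewrite nrm_sqr -TA T_perp.
have Q_perp x n : << Q x, e n.+1 >> = 0.
  by have [p <-] := T_range n; rewrite Q_sa /Q QT0 ip0r.
have QE x : Q x = << Q x, e 0%N >> *: e 0%N.
  apply: eq_from_coord => -[|n].
    by rewrite ipZl e_on mulr1.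
  by rewrite Q_perp ipZl e_on mulr0.
pose r := nrm (T (e 0%N)) ^+ 2.
have rE : << Q (e 0%N), e 0%N >> = r%:C.
  by rewrite /Q ipBl AT -nrm_sqr [X in _ - X]TA A_e0 ip0r subr0.
have Q_r x : Q x = r%:C *: (<< x, e 0%N >> *: e 0%N).
  by rewrite QE Q_sa (QE (e 0%N)) rE ipZr conj_realC scalerA.
exists r => //; rewrite lt_def sqr_ge0 andbT; apply/eqP => r0.
apply: T_nonnormal => x; apply/eqP; rewrite -subr_eq0.
by rewrite -/(Q x) Q_r r0 scale0r.
Qed.

End RieszFischer.
End Hilbert.

(** * Stability in l2 of a contracting recursion *)

(** Convexity of the square, for the weights [1 - rho] and [rho] at the points
    [y / (1 - rho)] and [g]. *)
Lemma sqr_convex (R : realFieldType) (rho y g : R) : 0 <= rho -> rho < 1 ->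
  (y + rho * g) ^+ 2 <= (1 - rho)^-1 * y ^+ 2 + rho * g ^+ 2.
Proof.
move=> rho0 rho1; have d0 : 0 < 1 - rho by lra.
rewrite -(ler_pM2l d0) mulrDr mulVKf ?gt_eqF //.
have : 0 <= rho * (y - (1 - rho) * g) ^+ 2 by rewrite mulr_ge0 ?sqr_ge0.
nra.
Qed.

(** The quantity [P N = (1 - rho) * \sum_(n < N) G n ^+ 2 + G N ^+ 2] grows at
    each step by at most [(1 - rho)^-1 * Y N ^+ 2] once [tau N <= rho], by
    [sqr_convex]; over the first [n0] steps it is controlled with a constant
    that depends on [tau] only. *)
Lemma l2_recursion (R : realFieldType) (tau : nat -> R) (rho : R) (n0 : nat) :
  (forall n, 0 <= tau n) -> 0 <= rho -> rho < 1 ->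
  (forall n, (n0 <= n)%N -> tau n <= rho) ->
  exists2 K : R, 0 <= K & forall (G Y : nat -> R) (S : R),
    (forall n, 0 <= G n) -> (forall n, 0 <= Y n) -> G 0%N = 0 ->
    (forall n, G n.+1 <= Y n + tau n * G n) ->
    (forall N, \sum_(0 <= n < N) Y n ^+ 2 <= S) ->
    forall N, \sum_(0 <= n < N) G n ^+ 2 <= K * S.
Proof.
move=> tau0 rho0 rho1 tau_rho; have d0 : 0 < 1 - rho by lra.
pose P (G : nat -> R) N := (1 - rho) * (\sum_(0 <= n < N) G n ^+ 2) + G N ^+ 2.
have [D D0 PD] : exists2 D, 0 <= D & forall G Y : nat -> R,
    (forall n, 0 <= G n) -> (forall n, 0 <= Y n) -> G 0%N = 0 ->
    (forall n, G n.+1 <= Y n + tau n * G n) ->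
    P G n0 <= D * \sum_(0 <= n < n0) Y n ^+ 2.
  elim: n0 {tau_rho} => [|n [D D0 PD]].
    exists 0 => // G Y G0 Y0 G00 GY.
    by rewrite /P !big_geq // G00 expr0n mulr0 addr0 mul0r.
  exists (D * (1 + 2 * tau n ^+ 2) + 2) => [|G Y G0 Y0 G00 GY].
    by rewrite addr_ge0 // mulr_ge0 // addr_ge0 // mulr_ge0 // sqr_ge0.
  have := PD G Y G0 Y0 G00 GY; rewrite /P !big_nat_recr //=.
  set E := \sum_(0 <= i < n) _; set F := \sum_(0 <= i < n) _ => IH.
  have E0 : 0 <= E by apply: sumr_ge0 => i _; apply: sqr_ge0.
  have F0 : 0 <= F by apply: sumr_ge0 => i _; apply: sqr_ge0.
  have sq : G n.+1 ^+ 2 <= 2 * Y n ^+ 2 + 2 * tau n ^+ 2 * G n ^+ 2.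
    apply: (@le_trans _ _ ((Y n + tau n * G n) ^+ 2)).
      by rewrite ler_pXn2r ?nnegrE // (le_trans (G0 _) (GY n)).
    have := sqr_ge0 (Y n - tau n * G n); nra.
  have t0 : 0 <= tau n ^+ 2 by apply: sqr_ge0.
  have y0 : 0 <= Y n ^+ 2 by apply: sqr_ge0.
  have g0 : 0 <= G n ^+ 2 by apply: sqr_ge0.
  move: (tau n ^+ 2) (Y n ^+ 2) (G n ^+ 2) (G n.+1 ^+ 2) t0 y0 g0 sq IH.
  move=> t y g g' t0 y0 g0 sq IH.
  have h1 : 0 <= D * (1 + 2 * t) * y.
    by rewrite !mulr_ge0 // addr_ge0 // mulr_ge0.
  have h2 : (1 + 2 * t) * ((1 - rho) * E + g) <= (1 + 2 * t) * (D * F).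
    by apply: ler_wpM2l => //; lra.
  have h3 : 0 <= rho * g by apply: mulr_ge0.
  have h4 : 0 <= t * ((1 - rho) * E) by rewrite !mulr_ge0 // ltW.
  nra.
exists ((1 - rho)^-1 * (D + (1 - rho)^-1)).
  have i0 : 0 <= (1 - rho)^-1 by rewrite invr_ge0 ltW.
  by rewrite mulr_ge0 // addr_ge0.
move=> G Y S G0 Y0 G00 GY YS.
have step m : P G (n0 + m)%N <=
    D * \sum_(0 <= n < n0) Y n ^+ 2
      + (1 - rho)^-1 * \sum_(n0 <= n < n0 + m) Y n ^+ 2.
  elim: m => [|m IH].
    by rewrite addn0 [X in _ <= _ + _ * X]big_geq // mulr0 addr0 PD.
  rewrite addnS [X in _ <= _ + _ * X]big_nat_recr ?leq_addr //=.
  move: IH; rewrite /P [in X in _ -> X]big_nat_recr //=.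
  set n := (n0 + m)%N.
  have : G n.+1 ^+ 2 <= (1 - rho)^-1 * Y n ^+ 2 + rho * G n ^+ 2.
    apply: le_trans (sqr_convex (Y n) (G n) rho0 rho1).
    rewrite ler_pXn2r ?nnegrE ?addr_ge0 ?mulr_ge0 //.
    apply: le_trans (GY n) _; rewrite lerD2l ler_wpM2r //.
    exact/tau_rho/leq_addr.
  lra.
have mono N : \sum_(0 <= n < N) G n ^+ 2 <= \sum_(0 <= n < n0 + N) G n ^+ 2.
  rewrite (big_cat_nat (leq0n N) (leq_addl n0 N)) /= lerDl.
  by apply: sumr_ge0 => i _; apply: sqr_ge0.
move=> N; apply: le_trans (mono N) _.
rewrite -mulrA -ler_pdivrMl ?invr_gt0 // invrK.
apply: (@le_trans _ _ (P G (n0 + N)%N)); first by rewrite lerDl sqr_ge0.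
apply: le_trans (step N) _; rewrite mulrDl; apply: lerD.
  by apply: ler_wpM2l.
apply: ler_wpM2l; first by rewrite invr_ge0 ltW.
apply: le_trans (YS (n0 + N)%N).
rewrite (big_cat_nat (leq0n n0) (leq_addr N n0)) /= lerDr.
by apply: sumr_ge0 => i _; apply: sqr_ge0.
Qed.

Lemma limsup_lt1_bounds (R : realType) (u : nat -> R) :
  (forall n, 0 <= u n) -> (limn_esup (fun n => (u n)%:E) < 1%:E)%E ->
  exists n0 (rho B : R), [/\ 0 <= rho, rho < 1,
     forall n, (n0 <= n)%N -> u n <= rho & forall n, u n <= B].
Proof.
move=> u0; rewrite limn_esup_lim (cvg_lim _ (@cvg_esups_inf _ _)) //.
move=> /ereal_inf_lt [_ [n0 _ <-]] un0.
have u_lt n : (n0 <= n)%N -> ((u n)%:E <= esups (fun n => (u n)%:E) n0)%E.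
  by move=> n0n; apply: ereal_sup_ubound; exists n.
have [rho rhoE] : exists rho, esups (fun n => (u n)%:E) n0 = rho%:E.
  have := u_lt n0 (leqnn _); case: esups un0 => [r| |] //= _ _; first by exists r.
rewrite rhoE lte_fin in un0.
have u_rho n : (n0 <= n)%N -> u n <= rho.
  by move=> /u_lt; rewrite rhoE lee_fin.
exists n0, rho, (rho + \sum_(0 <= i < n0) u i).
have rho0 : 0 <= rho := le_trans (u0 n0) (u_rho n0 (leqnn _)).
split=> // n; have [/u_rho un|nn0] := leqP n0 n.
  by apply: le_trans un _; rewrite lerDl sumr_ge0.
apply: le_trans (_ : \sum_(0 <= i < n0) u i <= _); last by rewrite lerDr.
rewrite (big_rem n) ?mem_index_iota //= lerDl sumr_ge0 //.
Qed.

Lemma sup_bounded (R : realType) (u : nat -> R) :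
  (forall n, 0 <= u n) -> (ereal_sup (range (fun n => (u n)%:E)) < +oo)%E ->
  exists2 B : R, 0 <= B & forall n, u n <= B.
Proof.
move=> u0.
have u_le n : ((u n)%:E <= ereal_sup (range (fun n => (u n)%:E)))%E.
  by apply: ereal_sup_ubound; exists n.
case: ereal_sup u_le => [B| |] // u_le _; last by have := u_le 0%N.
exists B => [|n]; last by rewrite -lee_fin.
by apply: (le_trans (u0 0%N)); rewrite -lee_fin.
Qed.

(** * The shift on coordinates *)

(** Let [c] be the coordinates of [x] and [g] those of the shifted vector, with
    respect to [f n = u n + t n * u n.+1].  In terms of [u], [x] has coordinates
    [c n + t n.-1 * c n.-1], and multiplication by [w] acts on [u] as a weighted
    shift; the recursion for [g] says that the coordinates of both sides in [u]
    agree, except at the end of the sums. *)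
Lemma shift_partial_sums (F : comPzRingType) (w : F) (s t u c g : nat -> F) :
  (forall n, w * u n = s n * u n.+1) ->
  g 0%N = 0 -> g 1%N = s 0%N * c 0%N ->
  (forall n, g n.+2 = s n.+1 * (c n.+1 + t n * c n) - t n.+1 * g n.+1) ->
  forall N,
  \sum_(0 <= n < N.+2) g n * (u n + t n * u n.+1)
    - w * \sum_(0 <= n < N.+1) c n * (u n + t n * u n.+1)
  = t N.+1 * g N.+1 * u N.+2 - w * (t N * c N * u N.+1).
Proof.
move=> wu g0 g1 gS; elim=> [|N IH].
  rewrite !big_nat_recr //= !big_geq // g0 g1.
  transitivity (t 1%N * (s 0%N * c 0%N) * u 2%N - w * (t 0%N * c 0%N * u 1%N)
     + c 0%N * (s 0%N * u 1%N - w * u 0%N)); first by ring.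
  by rewrite wu subrr mulr0 addr0.
rewrite big_nat_recr //= [in X in _ - X]big_nat_recr //=.
rewrite [w * (_ + _)]mulrDr opprD addrACA IH gS.
transitivity (t N.+2 * (s N.+1 * (c N.+1 + t N * c N) - t N.+1 * g N.+1) * u N.+3
  - w * (t N.+1 * c N.+1 * u N.+2)
  + (c N.+1 + t N * c N) * (s N.+1 * u N.+2 - w * u N.+1)); first by ring.
by rewrite wu subrr mulr0 addr0.
Qed.

(** * Evaluation on the disc *)

Section Evaluation.
Variables (R : realType) (k : disc_kernel R) (H : rkhs k).
Implicit Types (x y : H) (w : disc R) (c : R[i]).

Lemma ev_bounded x w : cmod (ev H x w) <= nrm x * nrm (kernel_section H w).
Proof. rewrite -reproducing; exact: (cauchy_schwarz (@normE _ _ H)). Qed.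

Lemma evD x y w : ev H (x + y) w = ev H x w + ev H y w.
Proof. by rewrite -[x]scale1r ev_linear mul1r scale1r. Qed.

Lemma ev0 w : ev H 0 w = 0.
Proof.
have := evD 0 0 w; rewrite addr0 => /eqP.
by rewrite -[X in X == _]addr0 (inj_eq (addrI _)) => /eqP.
Qed.

Lemma ev_lincomb (c : nat -> R[i]) (e : nat -> H) N w :
  ev H (\sum_(0 <= n < N) c n *: e n) w = \sum_(0 <= n < N) c n * ev H (e n) w.
Proof.
elim: N => [|N IH]; first by rewrite !big_geq // ev0.
by rewrite !big_nat_recr //= addrC ev_linear IH addrC.
Qed.

Lemma ev_ext x y : (forall w, ev H x w = ev H y w) -> x = y.
Proof. by move=> xy; apply: ev_inj; apply: boolp.funext. Qed.

(** Keeps the underlying complex number folded under simplification. *)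
Definition pt w : R[i] := val w.

Lemma disc_norm w : cmod (pt w) <= 1.
Proof. by rewrite -lecR -normE_cmod; apply: ltW (valP w). Qed.

Definition disc_opp w : disc R.
Proof. by exists (- val w); rewrite normrN (valP w). Defined.

Lemma pt_disc_opp w : pt (disc_opp w) = - pt w.
Proof. by []. Qed.

Definition disc0 : disc R.
Proof. by exists 0; rewrite normr0 ltr01. Defined.
End Evaluation.

(** * The shift of a tridiagonal space *)

Section Tridiagonal.
Variables (R : realType) (k : disc_kernel R) (H : rkhs k).
Variables (a b : nat -> R[i]) (f : nat -> H).
Hypothesis Hf : semi_analytic_tridiagonal a b f.
Implicit Types (x y : H) (w : disc R).

Local Notation ip := (@ip R H (inner H)).
Local Notation "<< x , y >>" := (ip x y).
Local Notation s := (fun n => a n / a n.+1).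
Local Notation t := (fun n => b n / a n.+1).
Local Notation u := (fun w n => a n * pt w ^+ n).

Lemma f_orthonormal : orthonormal_seq (inner H) f.
Proof. by case: (sat_basis Hf). Qed.

Lemma f_total : total_seq f.
Proof. by case: (sat_basis Hf). Qed.

Lemma ev_f_factored n w : ev H (f n) w = (a n + b n * pt w) * pt w ^+ n.
Proof. exact: (sat_ev Hf). Qed.

Lemma ev_f n w : ev H (f n) w = u w n + t n * u w n.+1.
Proof.
rewrite ev_f_factored mulrDl exprS !mulrA divfK ?(sat_neq0 Hf) //.
Qed.

Lemma mul_monomial n w : pt w * u w n = s n * u w n.+1.
Proof. by rewrite /= [RHS]mulrA divfK ?(sat_neq0 Hf) // exprS mulrCA. Qed.

(** The reproducing property bounds only [f n (w)], in which [u w n] and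
    [t n * u w n.+1] could cancel; they have opposite parities, so adding the
    value at [- w] isolates the first. *)
Lemma monomial_bounded w : exists2 B : R, 0 <= B & forall n, cmod (u w n) <= B.
Proof.
pose B w := nrm (kernel_section H w).
exists (B w + B (disc_opp w)) => [|n]; first by rewrite addr_ge0 ?nrm_ge0.
have f_le v : cmod (ev H (f n) v) <= B v.
  apply: le_trans (ev_bounded _ _) _.
  by rewrite (nrm_orthonormal (@normE _ _ H) f_orthonormal) mul1r.
have uE : 2 * u w n = ev H (f n) w + (-1) ^+ n * ev H (f n) (disc_opp w).
  rewrite !ev_f_factored pt_disc_opp (exprNn (pt w)).
  set e : R[i] := (-1) ^+ n.
  have ee : e * e = 1 by rewrite -expr2 sqrr_sign.
  transitivity ((a n + b n * pt w) * pt w ^+ n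
     + e * e * ((a n - b n * pt w) * pt w ^+ n)); last by ring.
  by rewrite ee; ring.
have c2 : cmod (2 : R[i]) = 2.
  by apply: realC_inj; rewrite -normE_cmod normr_nat rmorph_nat.
have c1 : cmod ((-1) ^+ n : R[i]) = 1.
  by apply: realC_inj; rewrite -normE_cmod normr_sign.
have : cmod (2 * u w n) <= B w + B (disc_opp w).
  rewrite uE; apply: le_trans (ler_cmodD _ _) _; rewrite cmodM c1 mul1r.
  exact: lerD.
rewrite cmodM c2; have := cmod_ge0 (u w n); lra.
Qed.

(** The coordinates [g] of the image are produced by the recursion that makes
    the function [w * x (w)] expand along [f]; stability of the recursion bounds
    their l2 norm, and the equality of functions is obtained by passing to the
    limit in [shift_partial_sums]. *)
Lemma shift_exists : exists2 M : R, 0 <= M & forall x, exists y,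
  (forall w, ev H y w = pt w * ev H x w) /\ nrm y <= M * nrm x.
Proof.
have [n0 [rho [Bt [rho0 rho1 t_rho t_Bt]]]] :=
  limsup_lt1_bounds (fun n => cmod_ge0 (t n)) (sat_limsup Hf).
have [Bs Bs0 s_Bs] := sup_bounded (fun n => cmod_ge0 (s n)) (sat_sup Hf).
have Bt0 : 0 <= Bt := le_trans (cmod_ge0 _) (t_Bt 0%N).
have [K K0 l2K] := l2_recursion (fun n => cmod_ge0 (t n)) rho0 rho1 t_rho.
pose M2 := K * (2 * Bs ^+ 2 * (1 + Bt ^+ 2)).
have M20 : 0 <= M2.
  by rewrite !mulr_ge0 ?addr_ge0 // exprn_ge0.
(* [M2] bounds the squared norm: the factor [2 * Bs ^+ 2 * (1 + Bt ^+ 2)] is for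
   the right-hand side of the recursion, [K] for its solution. *)
exists (Num.sqrt M2); first exact: sqrtr_ge0.
move=> x; pose c n : R[i] := << x, f n >>.
(* [c n + d n] is the coordinate of [x] along [u n]. *)
pose d n : R[i] := if n is m.+1 then t m * c m else 0.
pose g := fix g n : R[i] := if n is m.+1 then s m * (c m + d m) - t m * g m else 0.
have c_sum N : \sum_(0 <= n < N) cmod (c n) ^+ 2 <= nrm x ^+ 2.
  exact: (bessel (@normE _ _ H) f_orthonormal).
have d_sum N : \sum_(0 <= n < N) cmod (d n) ^+ 2 <= Bt ^+ 2 * nrm x ^+ 2.
  case: N => [|N]; first by rewrite big_geq // mulr_ge0 // sqr_ge0.
  have d0 : cmod (d 0%N) = 0 by exact: cmod0.
  rewrite big_nat_recl // d0 expr0n add0r.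
  apply: le_trans (ler_wpM2l _ (c_sum N)); last exact: sqr_ge0.
  rewrite mulr_sumr; apply: ler_sum => n _.
  rewrite cmodM exprMn ler_wpM2r ?sqr_ge0 //.
  by rewrite ler_pXn2r ?nnegrE ?cmod_ge0 // t_Bt.
pose Y n := cmod (s n * (c n + d n)).
have Y_sum N : \sum_(0 <= n < N) Y n ^+ 2
    <= 2 * Bs ^+ 2 * (1 + Bt ^+ 2) * nrm x ^+ 2.
  apply: (@le_trans _ _ (2 * Bs ^+ 2 * (\sum_(0 <= n < N) cmod (c n) ^+ 2
     + \sum_(0 <= n < N) cmod (d n) ^+ 2))).
    rewrite -big_split mulr_sumr; apply: ler_sum => n _ /=.
    rewrite /Y cmodM exprMn [2 * _]mulrC -[leRHS]mulrA; apply: ler_pM.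
    - exact: sqr_ge0.
    - exact: sqr_ge0.
    - by rewrite ler_pXn2r ?nnegrE ?cmod_ge0 // s_Bs.
    apply: (@le_trans _ _ ((cmod (c n) + cmod (d n)) ^+ 2)).
      by rewrite ler_pXn2r ?nnegrE ?addr_ge0 ?cmod_ge0 // ler_cmodD.
    have := sqr_ge0 (cmod (c n) - cmod (d n)); nra.
  rewrite -[leRHS]mulrA; apply: ler_wpM2l.
    by rewrite mulr_ge0 // sqr_ge0.
  by rewrite mulrDl mul1r lerD.
have g_sum N : \sum_(0 <= n < N) cmod (g n) ^+ 2 <= M2 * nrm x ^+ 2.
  rewrite /M2 -[leRHS]mulrA.
  apply: (l2K (fun n => cmod (g n)) Y) => // [n|n||n].
  - exact: cmod_ge0.
  - exact: cmod_ge0.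
  - exact: cmod0.
  - by apply: le_trans (ler_cmodD _ _) _; rewrite cmodN [X in _ + X]cmodM.
have [z [zg z_le]] := riesz_fischer (@normE _ _ H) f_orthonormal g_sum.
exists z; split; last first.
  rewrite -(@ler_pXn2r _ 2%N) ?nnegrE ?mulr_ge0 ?sqrtr_ge0 ?nrm_ge0 //.
  by rewrite exprMn sqr_sqrtr.
move=> w; have [Bu Bu0 u_Bu] := monomial_bounded w.
set kappa := nrm (kernel_section H w).
apply/eqP; rewrite -subr_eq0; apply/eqP/cmod0_eq0/eqP.
rewrite eq_le cmod_ge0 andbT; apply/ler_addgt0Pr => eps eps0; rewrite add0r.
(* The error [ev z - w * ev x] has two tails, each at most [delta * kappa], and
   two boundary terms, each at most [delta * (Bt * Bu)]. *)
pose L := 2 * (kappa + Bt * Bu) + 1.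
have L0 : 0 < L.
  by rewrite ltr_wpDl // mulr_ge0 // addr_ge0 ?nrm_ge0 // mulr_ge0.
have approx := expansion_approx (@normE _ _ H) f_orthonormal f_total.
pose delta := eps / L.
have delta0 : 0 < delta by apply: divr_gt0.
have [Nx Hx] := approx x _ delta0; have [Nz Hz] := approx z _ delta0.
pose N := maxn Nx Nz.
(* The coordinate number [n] is that of the tail starting at [n]. *)
have coef_le y n : (forall m, (N <= m)%N -> nrm (y - expansion (inner H) f y m) < delta) ->
    (N <= n)%N -> cmod << y, f n >> <= delta.
  move=> Hy nN; apply: le_trans (_ : nrm (y - expansion (inner H) f y n) <= _); last first.
    exact/ltW/Hy.
  have -> : << y, f n >> = << y - expansion (inner H) f y n, f n >>.
    by rewrite ipBl (ip_lincomb f_orthonormal) ltnn andbF subr0.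
  apply: le_trans (cauchy_schwarz (@normE _ _ H) _ _) _.
  by rewrite (nrm_orthonormal (@normE _ _ H) f_orthonormal) mulr1.
have Hx' m : (N <= m)%N -> nrm (x - expansion (inner H) f x m) < delta.
  by move=> Nm; apply: Hx; apply: leq_trans Nm; apply: leq_maxl.
have Hz' m : (N <= m)%N -> nrm (z - expansion (inner H) f z m) < delta.
  by move=> Nm; apply: Hz; apply: leq_trans Nm; apply: leq_maxr.
have ev_split y m : ev H y w = ev H (y - expansion (inner H) f y m) w
     + \sum_(0 <= n < m) << y, f n >> * (u w n + t n * u w n.+1).
  rewrite -{1}(subrK (expansion (inner H) f y m) y) [LHS]evD; congr (_ + _).
  by rewrite ev_lincomb; apply: eq_bigr => n _; rewrite ev_f.
have Fidentity : \sum_(0 <= n < N.+2) << z, f n >> * (u w n + t n * u w n.+1)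
    - pt w * \sum_(0 <= n < N.+1) << x, f n >> * (u w n + t n * u w n.+1)
  = t N.+1 * << z, f N.+1 >> * u w N.+2 - pt w * (t N * << x, f N >> * u w N.+1).
  apply: (shift_partial_sums (s := s) (t := t) (u := u w) (g := fun n => << z, f n >>)).
  - by move=> n; apply: mul_monomial.
  - by rewrite zg.
  - by rewrite zg /= addr0 mulr0 subr0.
  - by move=> n; rewrite !zg.
rewrite (ev_split z N.+2) (ev_split x N.+1) mulrDr opprD addrACA Fidentity.
have ev_le y : nrm y < delta -> cmod (ev H y w) <= delta * kappa.
  move=> yd; apply: le_trans (ev_bounded _ _) _.
  by apply: ler_wpM2r (ltW yd); apply: nrm_ge0.
have w_le z' B : cmod z' <= B -> cmod (pt w * z') <= B.
  move=> zB; rewrite cmodM; apply: le_trans zB.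
  by rewrite ler_piMl ?cmod_ge0 // disc_norm.
have bd_le y n m : cmod << y, f n >> <= delta ->
    cmod (t n * << y, f n >> * u w m) <= delta * (Bt * Bu).
  move=> yd; rewrite cmodM (cmodM (t n)) [delta * _]mulrA [delta * Bt]mulrC.
  by rewrite !ler_pM ?mulr_ge0 ?cmod_ge0 // ?t_Bt ?u_Bu.
apply: (@le_trans _ _ (delta * L)); last by rewrite divfK // gt_eqF.
apply: le_trans (ler_cmodD _ _) _.
have h1 := ler_cmodD (ev H (z - expansion (inner H) f z N.+2) w)
  (- (pt w * ev H (x - expansion (inner H) f x N.+1) w)).
have h2 := ler_cmodD (t N.+1 * << z, f N.+1 >> * u w N.+2)
  (- (pt w * (t N * << x, f N >> * u w N.+1))).
rewrite !cmodN in h1 h2.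
have h3 := ev_le _ (Hz' N.+2 (leqW (leqnSn N))).
have h4 := w_le _ _ (ev_le _ (Hx' N.+1 (leqnSn N))).
have h5 := bd_le z N.+1 N.+2 (coef_le z _ Hz' (leqnSn N)).
have h6 := w_le _ _ (bd_le x N N.+1 (coef_le x _ Hx' (leqnn N))).
rewrite /L; nra.
Qed.

Lemma ev_mult_z x w : ev H (mult_z H x) w = pt w * ev H x w.
Proof.
have [M _ shift] := shift_exists; have [y [yx _]] := shift x.
have : exists y, forall w, ev H y w = val w * ev H x w by exists y.
by move=> /xgetPex; apply.
Qed.

Lemma mult_z_linear (c : R[i]) x y :
  mult_z H (c *: x + y) = c *: mult_z H x + mult_z H y.
Proof.
apply: ev_ext => w; rewrite ev_linear !ev_mult_z ev_linear; ring.
Qed.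

Lemma mult_z_bounded :
  exists2 M : R, 0 <= M & forall x, nrm (mult_z H x) <= M * nrm x.
Proof.
have [M M0 shift] := shift_exists; exists M => // x.
have [y [yx y_le]] := shift x.
suff -> : mult_z H x = y by [].
by apply: ev_ext => w; rewrite ev_mult_z yx.
Qed.

Lemma bounded_op_mult_z : bounded_op (mult_z H).
Proof.
split; first exact: mult_z_linear.
have [M _ M_le] := mult_z_bounded; exists M => x.
by rewrite !normE_nrm -rmorphM lecR.
Qed.

Lemma adjoint_mult_zP x y :
  << mult_z H x, y >> = << x, adjoint (mult_z H) y >>.
Proof.
have [M M0 M_le] := mult_z_bounded.
have := adjoint_exists (@normE _ _ H) f_orthonormal f_total mult_z_linear M0 M_le y.
by move=> /xgetPex; apply.
Qed.

(** Only [f 0] does not vanish at [0], so evaluation at [0] is [a 0] times the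
    coordinate along [f 0]; and a function divisible by [w] vanishes at [0]. *)
Lemma mult_z_perp x : << mult_z H x, f 0%N >> = 0.
Proof.
have ev_at0 y : ev H y (disc0 R) - a 0%N * << y, f 0%N >> = 0.
  apply: (@functional_ext _ _ _ (@normE _ _ H) _ f_orthonormal f_total
    (fun y => ev H y (disc0 R) - a 0%N * << y, f 0%N >>)
    (nrm (kernel_section H (disc0 R)) + cmod (a 0%N) * nrm (f 0%N)))
    => {y} [c y y'|y|n].
  - by rewrite ev_linear ipDl ipZl; ring.
  - apply: le_trans (ler_cmodD _ _) _; rewrite cmodN mulrDl.
    apply: lerD; first by rewrite mulrC ev_bounded.
    rewrite cmodM -mulrA [nrm (f _) * _]mulrC; apply: ler_wpM2l.
      exact: cmod_ge0.
    exact: (cauchy_schwarz (@normE _ _ H)).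
  - rewrite f_orthonormal ev_f_factored /pt /= mulr0 addr0 expr0n.
    by case: n => [|n]; rewrite ?mulr0 subrr.
have := ev_at0 (mult_z H x); rewrite ev_mult_z /pt /= mul0r sub0r => /eqP.
by rewrite oppr_eq0 mulf_eq0 (negbTE (sat_neq0 Hf _)) => /eqP.
Qed.

(** [f n.+1] is [w] times a polynomial. *)
Lemma mult_z_range n : exists p, mult_z H p = f n.+1.
Proof.
have [p pE] := sat_poly Hf (((a n.+1)%:P + b n.+1 *: 'X) * 'X^n).
exists p; apply: ev_ext => w.
rewrite ev_mult_z ev_f_factored pE !hornerE /= exprS -/(pt w); ring.
Qed.

Lemma orth_proj_f0 x :
  orth_proj (span_line (f 0%N)) x = << x, f 0%N >> *: f 0%N.
Proof.
have : exists y, span_line (f 0%N) y /\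
    forall v, span_line (f 0%N) v -> inner H (x - y) v = 0.
  exists (<< x, f 0%N >> *: f 0%N); split; first by exists << x, f 0%N >>.
  move=> _ [c ->]; rewrite -/(ip _ _) ipZr ipBl ipZl f_orthonormal mulr1 subrr.
  by rewrite mulr0.
rewrite /orth_proj => /(xgetPex 0) [[c ->]] /(_ (f 0%N)) /=.
have f0_line : span_line (f 0%N) (f 0%N) by exists 1; rewrite scale1r.
move=> /(_ f0_line); rewrite -/(ip _ _) ipBl ipZl f_orthonormal mulr1.
by move=> /eqP; rewrite subr_eq0 => /eqP ->.
Qed.

End Tridiagonal.

Theorem theorem6p2 (R : realType) (k : disc_kernel R)
    (k_posdef : posdef_kernel k) (k_analytic : analytic_kernel k)
    (H : rkhs k) (a b : nat -> R[i]) (f : nat -> H)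
    (Hf : semi_analytic_tridiagonal a b f)
    (nonnormal : ~ normal_op (mult_z H)) :
  quasinormal_op (mult_z H) <->
  exists2 r : R, 0 < r &
    forall x : H,
      adjoint (mult_z H) (mult_z H x) - mult_z H (adjoint (mult_z H) x)
      = r%:C *: orth_proj (span_line (f 0%N)) x.
Proof.
have T_bounded := bounded_op_mult_z Hf.
have [|QR RQ] := quasinormal_rank_one (@normE _ _ H) (f_orthonormal Hf)
  (f_total Hf) (adjoint_mult_zP Hf) (mult_z_perp Hf) (mult_z_range Hf).
  by move=> T_normal; apply: nonnormal; split.
split=> [[_ /QR[r r0 QE]]|[r r0 QE]].
  by exists r => // x; rewrite (orth_proj_f0 Hf) QE.
split=> //; apply: RQ; exists r => // x.
by rewrite QE (orth_proj_f0 Hf).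
Qed.
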